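(* Let $\varphi\colon\mathbb{R}^n\to\overline{\mathbb{R}}$ be a lower semicontinuous function, and fix $\bar x\in\mathbb{R}^n$ such that $|\varphi(\bar x)|<\infty$ as well as some direction $u\in\mathbb{S}$. Then the second-order growth condition holds for $\varphi$ in direction $u$ at $\bar x$ if and only if $\mathrm{d}^2\varphi(\bar x;0)(u)>0$.
   Context: $\overline{\mathbb{R}}:=\mathbb{R}\cup\{-\infty,\infty\}$; $\mathbb{R}^n$ carries the Euclidean norm $\|\cdot\|$ and inner product $\langle\cdot,\cdot\rangle$; $\mathbb{S}:=\{u\in\mathbb{R}^n : \|u\|=1\}$. Directional neighborhoods: for $\varepsilon,\rho>0$ and $u\in\mathbb{R}^n$, $\mathbb{B}_{\varepsilon,\rho}(u):=\{w\in\mathbb{R}^n : \|w\|\le\varepsilon,\ \big\|\|w\|u-\|u\|w\big\|\le\rho\|u\|\|w\|\}$. Second-order growth condition: it holds for $\varphi$ in direction $u$ at $\bar x$ if there are $\varepsilon,\rho,\kappa>0$ with $\varphi(x)\ge\varphi(\bar x)+\kappa\|x-\bar x\|^2$ for all $x\in\bar x+\mathbb{B}_{\varepsilon,\rho}(u)$. Second subderivative at $\bar x$ for $x^*\in\mathbb{R}^n$: $\mathrm{d}^2\varphi(\bar x;x^* )(u):=\liminf_{t\downarrow0,\,u'\to u}\frac{\varphi(\bar x+tu')-\varphi(\bar x)-t\langle x^*,u'\rangle}{\frac12t^2}$. *)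

(* Defs.v *)
From HB Require Import structures.
From mathcomp Require Import all_boot all_order all_algebra.
From mathcomp Require Import all_classical all_reals all_analysis.
Set Implicit Arguments.
Unset Strict Implicit.
Unset Printing Implicit Defensive.
Import Order.TTheory GRing.Theory Num.Theory.
Import numFieldNormedType.Exports.
Local Open Scope classical_set_scope.
Local Open Scope ring_scope.

Definition einner (R : realType) (n : nat) (u v : 'rV[R]_n) : R :=
  \sum_(i < n) u ord0 i * v ord0 i.

(* The library norm `|u| on 'rV[R]_n is the sup norm, hence this definition.
   Both induce the topology that the library puts on 'rV[R]_n. *)
Definition enorm (R : realType) (n : nat) (u : 'rV[R]_n) : R :=
  Num.sqrt (einner u u).

Definition dir_nbhd (R : realType) (n : nat) (eps rho : R) (u : 'rV[R]_n) :
    set 'rV[R]_n :=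
  [set w | enorm w <= eps /\
           enorm (enorm w *: u - enorm u *: w) <= rho * enorm u * enorm w].

Definition second_order_growth (R : realType) (n : nat)
    (phi : 'rV[R]_n -> \bar R) (xbar u : 'rV[R]_n) : Prop :=
  exists eps rho kappa : R,
    [/\ 0 < eps, 0 < rho, 0 < kappa &
        forall x : 'rV[R]_n, [set xbar + w | w in dir_nbhd eps rho u] x ->
          (phi xbar + (kappa * enorm (x - xbar) ^+ 2)%:E <= phi x)%E].

(* The difference quotient at (t, u'); division by t^2 / 2 is multiplication
   by the extended real of its inverse.  It is meant for finite phi xbar, so
   that no indeterminate form arises. *)
Definition second_quotient (R : realType) (n : nat)
    (phi : 'rV[R]_n -> \bar R) (xbar xstar : 'rV[R]_n)
    (p : R * 'rV[R]_n) : \bar R :=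
  ((phi (xbar + p.1 *: p.2)%R - phi xbar - (p.1 * einner xstar p.2)%:E)
     * ((2^-1 * p.1 ^+ 2)^-1)%:E)%E.

(* 0^'+ encodes t > 0, t -> 0; nbhs u is not punctured: u' = u is allowed. *)
Definition second_subderivative (R : realType) (n : nat)
    (phi : 'rV[R]_n -> \bar R) (xbar xstar u : 'rV[R]_n) : \bar R :=
  limf_einf (second_quotient phi xbar xstar) (filter_prod 0^'+ (nbhs u)).

(* Main.v *)
Require Import Defs.
From HB Require Import structures.
From mathcomp Require Import all_boot all_order all_algebra.
From mathcomp Require Import all_classical all_reals all_analysis.
From mathcomp Require Import ring lra.
Set Implicit Arguments.
Unset Strict Implicit.
Unset Printing Implicit Defensive.
Import Order.TTheory GRing.Theory Num.Theory.
Import numFieldNormedType.Exports.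
Local Open Scope classical_set_scope.
Local Open Scope ring_scope.

(** Both properties say the same thing after the change of variables
    [w = t *: v], where [x = xbar + w]: the growth inequality
    [phi xbar + kappa * ||w||^2 <= phi (xbar + w)], divided by [t^2 / 2], is a
    lower bound [2 kappa ||v||^2 <= second_quotient phi xbar 0 (t, v)]
    ([le_second_quotient0]).  A positive lower limit is a positive constant
    which bounds the quotient from below for [t > 0] small and [v] close to [u]
    ([limf_einf_gt0P]), so only the neighborhoods have to be compared.

    From growth to the subderivative: for [v] close to [u], the vector [t *: v]
    lies in the directional neighborhood as soon as [t] is small, because the
    cone condition is invariant under positive scaling and holds strictly at
    [v = u]; moreover [||v||] stays away from [0] ([near_dir_nbhd]).
    Conversely a nonzero [w] of the directional neighborhood is [t *: v] with
    [t = ||w||] and [v = w / ||w||], and since [||u|| = 1] the cone condition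
    says exactly that [||u - v|| <= rho] ([dir_nbhd_normalize]). *)

Section EuclideanNorm.
Context {R : realType} {n : nat}.
Implicit Types (u v w : 'rV[R]_n) (t : R).

Lemma einner0l v : einner 0 v = 0.
Proof. by rewrite /einner big1// => i _; rewrite mxE mul0r. Qed.

Lemma enorm_ge0 u : 0 <= enorm u.
Proof. exact: sqrtr_ge0. Qed.

Lemma enorm0 : enorm (0 : 'rV[R]_n) = 0.
Proof. by rewrite /enorm einner0l sqrtr0. Qed.

Lemma enormZ t u : 0 <= t -> enorm (t *: u) = t * enorm u.
Proof.
move=> t0; rewrite /enorm.
have -> : einner (t *: u) (t *: u) = t ^+ 2 * einner u u.
  by rewrite /einner mulr_sumr; apply: eq_bigr => i _; rewrite !mxE; ring.
by rewrite sqrtrM ?sqr_ge0// sqrtr_sqr ger0_norm.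
Qed.

(** One of the summands under the square root is the square of the largest
    coordinate, whose absolute value is the sup norm. *)
Lemma norm_le_enorm u : `|u| <= enorm u.
Proof.
rewrite /Num.norm/= mx_normrE; apply: bigmax_le => [|[i j] _ /=].
  exact: enorm_ge0.
rewrite -sqrtr_sqr ler_wsqrtr// ord1 /einner (bigD1 j)//= -expr2 lerDl.
by apply: sumr_ge0 => k _; rewrite -expr2 sqr_ge0.
Qed.

Lemma enorm_eq0 u : enorm u = 0 -> u = 0.
Proof.
by move=> u0; apply/eqP; rewrite -normr_le0 -u0; exact: norm_le_enorm.
Qed.

Lemma enorm_continuous : continuous (@enorm R n).
Proof.
move=> u; apply: (@continuous_comp _ _ _ (fun u => einner u u)); last first.
  exact: sqrt_continuous.
apply: (@continuous_big _ _ _ _ _ _ _ _ (fun i v => v ord0 i * v ord0 i)).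
  by move=> [x y]; apply: (@continuousD _ _ _ fst snd);
    [exact: cvg_fst|exact: cvg_snd].
by move=> i _ v; apply: continuousM; exact: coord_continuous.
Qed.

End EuclideanNorm.

Section DirectionalNeighborhood.
Context {R : realType} {n : nat} {u : 'rV[R]_n} (u1 : enorm u = 1).

(** The cone condition [||  ||v|| u - v || <= rho ||v||] does not depend on
    [t], and its left side is continuous in [v] and vanishes at [u], where
    [||u|| = 1].  The lower bound [2^-1], for which any number strictly between
    [0] and [1] would do, makes [||t *: v||^2] comparable to [t^2]. *)
Lemma near_dir_nbhd (eps rho : R) : 0 < eps -> 0 < rho ->
  \forall p \near filter_prod 0^'+ (nbhs u),
    [/\ 0 < p.1, 2^-1 <= enorm p.2 & dir_nbhd eps rho u (p.1 *: p.2)].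
Proof.
move=> eps0 rho0.
pose dev v := enorm (enorm v *: u - v).
have dev_cont : continuous dev.
  move=> v; apply: (@continuous_comp _ _ _ (fun v => enorm v *: u - v)); last first.
    exact: enorm_continuous.
  apply: continuousB => //; apply: continuousZr_tmp; exact: enorm_continuous.
have dev0 : dev u = 0 by rewrite /dev u1 scale1r subrr enorm0.
have Ht : \forall t \near 0^'+, 0 < t /\ t * 2 <= eps :> R.
  near=> t; split; first by [].
  by rewrite -ler_pdivlMr//; near: t; apply: nbhs_right_le; rewrite divr_gt0.
have Hv : \forall v \near u, [/\ 2^-1 <= enorm v, enorm v <= 2 & dev v <= rho / 2].
  near=> v; split.
  - apply: ltW; near: v; apply: (cvgr_gt (enorm u)); first exact: enorm_continuous.
    by rewrite u1; lra.
  - apply: ltW; near: v; apply: (cvgr_lt (enorm u)); first exact: enorm_continuous.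
    by rewrite u1; lra.
  - apply: ltW; near: v; apply: (cvgr_lt (dev u)); first exact: dev_cont.
    by rewrite dev0 divr_gt0.
exists ([set t | 0 < t /\ t * 2 <= eps],
  [set v | [/\ 2^-1 <= enorm v, enorm v <= 2 & dev v <= rho / 2]]) => //.
move=> [t v] /= [[t0 te] [v1 v2 dv]]; split=> //; split.
  rewrite enormZ ?(ltW t0)//; apply: le_trans te.
  by rewrite ler_pM2l.
rewrite u1 scale1r mulr1 enormZ ?(ltW t0)//.
rewrite -scalerA -scalerBr enormZ ?(ltW t0)//.
rewrite mulrCA ler_pM2l//; apply: le_trans dv _.
by rewrite ler_pM2l.
Unshelve. all: by end_near. Qed.

(** After division by [||w||], the cone condition is a bound on the Euclidean
    distance from [u] to [w / ||w||]; it is weakened here to the sup norm, in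
    which the balls of the topology are given. *)
Lemma dir_nbhd_normalize (eps rho : R) (w : 'rV[R]_n) : w != 0 ->
  dir_nbhd eps rho u w ->
  0 < enorm w <= eps /\ `|u - (enorm w)^-1 *: w| <= rho.
Proof.
move=> w0 [weps]; rewrite u1 scale1r mulr1 => wrho.
have wp : 0 < enorm w.
  by rewrite lt_neqAle enorm_ge0 andbT eq_sym; apply: contra_neq w0 => /enorm_eq0.
split; first by rewrite wp.
apply: le_trans (norm_le_enorm _) _.
rewrite -(ler_pM2l wp) -enormZ ?enorm_ge0// scalerBr scalerA.
by rewrite divff ?gt_eqF// scale1r mulrC.
Qed.

End DirectionalNeighborhood.

(** The lower limit is a supremum of infima over the members of [F], so it is
    positive iff one of these infima is.  That infimum may be [+oo], hence the
    bound [c] below it in place of the infimum itself. *)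
Lemma limf_einf_gt0P (R : realType) (T : choiceType) (X : filteredType T)
    (f : X -> \bar R) (F : set_system X) : Filter F ->
  (0 < limf_einf f F)%E <->
  exists2 c : R, 0 < c & \forall x \near F, (c%:E <= f x)%E.
Proof.
move=> FF; rewrite limf_einfE; split=> [/ereal_sup_gt[_ [V FV <-]]|[c c0 Fc]].
  move=> inf_gt0.
  have [c c0 c_le] : exists2 c : R, 0 < c & (c%:E <= ereal_inf (f @` V))%E.
    case: (ereal_inf _) inf_gt0 => [r r0||//]; first by exists r.
    by exists 1 => //; rewrite leey.
  exists c => //; apply: filterS FV => x Vx.
  by apply: le_trans c_le _; apply: ereal_inf_lbound; exists x.
apply: (@lt_le_trans _ _ c%:E); first by rewrite lte_fin.
apply: (@le_trans _ _ (ereal_inf (f @` [set x | (c%:E <= f x)%E]))).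
  by apply: le_ereal_inf_tmp => _ [x cfx <-].
by apply: ereal_sup_ubound; exists [set x | (c%:E <= f x)%E].
Qed.

(** With zero linear term, the factor [t^2 / 2] and the finite value [phi xbar]
    may be moved to the other side even where [phi] is infinite. *)
Lemma le_second_quotient0 (R : realType) (n : nat) (phi : 'rV[R]_n -> \bar R)
    (xbar v : 'rV[R]_n) (c t : R) : phi xbar \is a fin_num -> 0 < t ->
  (c%:E <= second_quotient phi xbar 0 (t, v))%E =
  (phi xbar + (c / 2 * t ^+ 2)%:E <= phi (xbar + t *: v)%R)%E.
Proof.
move=> fin t0; rewrite /second_quotient /= einner0l mulr0 sube0.
rewrite lee_pdivlMr ?mulr_gt0 ?exprn_gt0//.
by rewrite leeBrDr// -EFinM addeC mulrA.
Qed.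

Theorem lemma3p14 (R : realType) (n : nat) (phi : 'rV[R]_n -> \bar R)
    (xbar u : 'rV[R]_n) :
  lower_semicontinuous phi ->
  (`|phi xbar| < +oo)%E ->
  enorm u = 1 ->
  second_order_growth phi xbar u <->
  (0 < second_subderivative phi xbar 0 u)%E.
Proof.
move=> _ phi_fin u1.
have fin : phi xbar \is a fin_num by rewrite fin_num_abs.
rewrite /second_subderivative limf_einf_gt0P; split.
- move=> [eps [rho [kappa [eps0 rho0 kappa0 growth]]]].
  (* The quotient is at least [2 * kappa * ||v||^2] with [||v|| >= 1/2]. *)
  exists (kappa / 2); first by rewrite divr_gt0.
  apply: filterS (near_dir_nbhd u1 eps0 rho0) => -[t v] /= [t0 v_ge tv].
  rewrite le_second_quotient0//.
  apply: le_trans (growth (xbar + t *: v) _); last by exists (t *: v).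
  rewrite leeD2l// lee_fin addrC addKr enormZ ?(ltW t0)// exprMn.
  rewrite [leRHS]mulrA [leRHS]mulrAC ler_pM2r ?exprn_gt0// -mulrA ler_pM2l//.
  by nra.
- move=> [c c0 [[T V] /= [T_near V_near] TV]].
  have /nbhs_ballP[d /= d0 dT] := T_near.
  have /nbhs_ballP[r /= r0 rV] := V_near.
  (* Halving [d] and [r] turns closed bounds into membership in open balls. *)
  exists (d / 2), (r / 2), (c / 2); split; rewrite ?divr_gt0// => _ [w w_dir <-].
  rewrite [X in enorm X](_ : _ = w); last by rewrite addrC addKr.
  have [->|w0] := eqVneq w 0.
    by rewrite enorm0 expr0n mulr0 adde0 addr0.
  have [/andP[w_gt0 w_le] w_near] := dir_nbhd_normalize u1 w0 w_dir.
  set t := enorm w in w_gt0 w_le w_near *.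
  rewrite -[w in X in (_ <= X)%E](scalerKV (lt0r_neq0 w_gt0)).
  rewrite -le_second_quotient0//; apply: (TV (_, _)); split => /=.
    apply: dT => //; rewrite -ball_normE /= sub0r normrN gtr0_norm//.
    by apply: le_lt_trans w_le _; lra.
  by apply: rV; rewrite -ball_normE /=; apply: le_lt_trans w_near _; lra.
Qed.
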